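(* Let $\ell$ be a positive integer. The group $D$ generated by all cyclic shifts $c_j$ ($j\in\mathbb{Z}_\ell$) and all decimations $d_k$ ($k\in\mathbb{Z}_\ell^\times$), with function composition as the group operation, acts on $\mathbb{C}^{\mathbb{Z}_\ell}$.
   Context: $\mathbb{Z}_\ell$ is the ring of integers modulo $\ell$, $\mathbb{Z}_\ell^\times$ its multiplicative group of units, and $\mathbb{C}^{\mathbb{Z}_\ell}$ the set of complex vectors indexed by $\mathbb{Z}_\ell$. For $j\in\mathbb{Z}_\ell$, the cyclic shift $c_j:\mathbb{C}^{\mathbb{Z}_\ell}\to\mathbb{C}^{\mathbb{Z}_\ell}$ is $(c_j(\mathbf{v}))_i=v_{i-j}$. For $k\in\mathbb{Z}_\ell^\times$, the decimation $d_k:\mathbb{C}^{\mathbb{Z}_\ell}\to\mathbb{C}^{\mathbb{Z}_\ell}$ is $(d_k(\mathbf{v}))_i=v_{ik^{-1}}$. The action is the one in which an element of $D$, being a map $\mathbb{C}^{\mathbb{Z}_\ell}\to\mathbb{C}^{\mathbb{Z}_\ell}$, is evaluated at a vector. *)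

(* Defs.v *)
From HB Require Import structures.
From mathcomp Require Import all_boot all_algebra.
From mathcomp Require Import boolp classical_sets reals.
From mathcomp Require Import complex.

Set Implicit Arguments.
Unset Strict Implicit.
Unset Printing Implicit Defensive.

Local Open Scope classical_set_scope.

(* Z_l is 'I_l with the operations Zp_* of zmodp, which are available at every
   modulus.  The type 'Z_l would not do, since 'Z_1 has two elements. *)

(* C is R[i], the complex numbers over a realType R. *)
Definition cvec (R : realType) (l : nat) : Type := {ffun 'I_l -> R[i]}.

Definition cshift (R : realType) (l : nat) (j : 'I_l) (v : cvec R l) :
    cvec R l :=
  [ffun i => v (Zp_add i (Zp_opp j))].

(* The congruence says that the product of k and k' in Z_l is the unit
   element; for l = 1 the only element of Z_1 is a unit. *)
Definition Zl_units (l : nat) : set 'I_l :=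
  [set k : 'I_l | exists k' : 'I_l, (k * k' = 1 %[mod l])%N].
Arguments Zl_units : clear implicits.

(* Zp_inv k is the inverse of k when k is a unit, and k otherwise. *)
Definition decimation (R : realType) (l : nat) (k : 'I_l) (v : cvec R l) :
    cvec R l :=
  [ffun i => v (Zp_mul i (Zp_inv k))].

(* Subgroups of the group of all bijections of X, under composition. *)
Definition transformation_group (X : Type) (H : set (X -> X)) : Prop :=
  [/\ H id,
      forall f g, H f -> H g -> H (f \o g)
    & forall f, H f -> exists2 g, H g & cancel f g /\ cancel g f].

Definition generated_group (X : Type) (S : set (X -> X)) : set (X -> X) :=
  smallest (@transformation_group X) S.

Definition groupD (R : realType) (l : nat) : set (cvec R l -> cvec R l) :=
  generated_group (range (@cshift R l) `|` @decimation R l @` Zl_units l).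
Arguments groupD : clear implicits.

(* H as a type; the unused argument hH lets the groupType instance below,
   whose product is composition, be inferred. *)
Definition tgroup (X : Type) (H : set (X -> X)) (hH : transformation_group H) :
  Type := set_type H.

Section TransformationGroup.
Variables (X : Type) (H : set (X -> X)) (hH : transformation_group H).

HB.instance Definition _ := gen_eqMixin (tgroup hH).
HB.instance Definition _ := gen_choiceMixin (tgroup hH).

Definition tgroup_fun (f : tgroup hH) : X -> X := \val f.

Lemma tgroup_funP (f : tgroup hH) : H (tgroup_fun f).
Proof. exact: set_mem (valP f). Qed.

Lemma tgroup_fun_inj : injective tgroup_fun.
Proof. exact: val_inj. Qed.

Lemma tgroup_one_subproof : H id.
Proof. by case: hH. Qed.

Lemma tgroup_mul_subproof (f g : tgroup hH) :
  H (tgroup_fun f \o tgroup_fun g).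
Proof. by case: hH => _ HM _; apply: HM; exact: tgroup_funP. Qed.

Lemma tgroup_inv_subproof (f : tgroup hH) : exists2 g, H g &
  cancel (tgroup_fun f) g /\ cancel g (tgroup_fun f).
Proof. by case: hH => _ _; apply; exact: tgroup_funP. Qed.

Definition tgroup_one : tgroup hH := exist _ id (mem_set tgroup_one_subproof).
Definition tgroup_mul (f g : tgroup hH) : tgroup hH :=
  exist _ (tgroup_fun f \o tgroup_fun g) (mem_set (tgroup_mul_subproof f g)).
Definition tgroup_inv (f : tgroup hH) : tgroup hH :=
  let g := cid2 (tgroup_inv_subproof f) in exist _ (s2val g) (mem_set (s2valP g)).

Lemma tgroup_mulA : associative tgroup_mul.
Proof. by move=> f g h; exact: tgroup_fun_inj. Qed.

Lemma tgroup_mul1 : left_id tgroup_one tgroup_mul.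
Proof. by move=> f; exact: tgroup_fun_inj. Qed.

Lemma tgroup_mulx1 : right_id tgroup_one tgroup_mul.
Proof. by move=> f; exact: tgroup_fun_inj. Qed.

Lemma tgroup_mulV : left_inverse tgroup_one tgroup_inv tgroup_mul.
Proof.
move=> f; apply: tgroup_fun_inj; apply/funext => x.
by case: (s2valP' (cid2 (tgroup_inv_subproof f))) => fK _; exact: fK.
Qed.

Lemma tgroup_mulxV : right_inverse tgroup_one tgroup_inv tgroup_mul.
Proof.
move=> f; apply: tgroup_fun_inj; apply/funext => x.
by case: (s2valP' (cid2 (tgroup_inv_subproof f))) => _ gK; exact: gK.
Qed.

HB.instance Definition _ := isGroup.Build (tgroup hH)
  tgroup_mulA tgroup_mul1 tgroup_mulx1 tgroup_mulV tgroup_mulxV.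

End TransformationGroup.

Definition group_action (G : groupType) (X : Type) (act : G -> X -> X) : Prop :=
  (forall x, act 1%g x = x) /\
  (forall g h x, act (g * h)%g x = act g (act h x)).

(* Main.v *)
Require Import Defs.
From mathcomp Require Import all_boot all_algebra.
From mathcomp Require Import boolp classical_sets reals complex.

(** Once [groupD R l] is known to be a group of transformations, the action
    axioms are the definitions of the identity map and of composition, so the
    content is that the smallest transformation group containing the shifts and
    the decimations exists.  An intersection of transformation groups is again
    one, but only if the family is nonempty: the intersection of the empty
    family is the set of all maps, which need not be invertible.  The family is
    nonempty as soon as the generators are bijections
    ([generated_group_transformation]), because then the group of all bijections
    belongs to it.

    Both kinds of generators reindex a vector along a map of Z_l: translation by
    [- j] and multiplication by the inverse of [k].  These maps of Z_l are
    bijective, hence so are the reindexings ([reindex_bij]). *)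

Local Open Scope classical_set_scope.

Lemma bijections_transformation_group (X : Type) :
  transformation_group [set f : X -> X | bijective f].
Proof.
split=> [|f g /= bij_f bij_g|f /= [g fK gK]].
- by exists id.
- exact: bij_comp.
- by exists g; first exact: Bijective gK fK.
Qed.

(** The bijections serve twice: they are a member of the family being
    intersected, and they provide one inverse of [f] independent of the member.
    By uniqueness of inverses it is the inverse that every member contains. *)
Lemma generated_group_transformation (X : Type) (S : set (X -> X)) :
  S `<=` [set f : X -> X | bijective f] -> transformation_group (generated_group S).
Proof.
move=> S_bij; split.
- by move=> H [[H1 _ _] _].
- move=> f g Df Dg H HS; have [[_ HM _] _] := HS.
  by apply: HM; [exact: Df|exact: Dg].
- move=> f Df.
  have bij_f : bijective f.
    exact: (smallest_sub (bijections_transformation_group X) S_bij Df).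
  case: (bij_f) => g fK gK; exists g => // H HS; have [[_ _ HV] _] := HS.
  have [g' Hg' [fK' _]] := HV f (Df H HS).
  suff -> : g = g' by [].
  exact/funext/(bij_can_eq bij_f fK fK').
Qed.

Lemma reindex_bij (I : finType) (T : Type) (s : I -> I) :
  bijective s -> bijective (fun v : {ffun I -> T} => [ffun i => v (s i)]).
Proof.
case=> t sK tK; exists (fun v : {ffun I -> T} => [ffun i => v (t i)]) => v;
  by apply/ffunP=> i; rewrite !ffunE ?sK ?tK.
Qed.

Lemma Zp_add_bij (l : nat) (j : 'I_l) : bijective (fun i => Zp_add i j).
Proof.
case: l j => [[]//|n] j.
exists (fun i => Zp_add i (Zp_opp j)) => i; rewrite -Zp_addA.
- by rewrite (Zp_addC j) Zp_addNz Zp_addC Zp_add0z.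
- by rewrite Zp_addNz Zp_addC Zp_add0z.
Qed.

(** A unit of Z_l is coprime to [l], which is the condition under which
    [Zp_inv k] is an actual inverse of [k]. *)
Lemma Zp_mul_inv_bij (l : nat) (k : 'I_l) :
  Zl_units l k -> bijective (fun i => Zp_mul i (Zp_inv k)).
Proof.
case: l k => [[]//|n] k [k' kk'].
have co_k : coprime n.+1 k.
  by apply: (@Zp_intro_unit n k k'); apply: val_inj; rewrite /= mulnC.
exists (fun i => Zp_mul i k) => i; rewrite -Zp_mulA.
- by rewrite Zp_mulVz // Zp_mulz1.
- by rewrite Zp_mulzV // Zp_mulz1.
Qed.

Lemma groupD_transformation (R : realType) (l : nat) :
  transformation_group (groupD R l).
Proof.
apply: generated_group_transformation => f [[j _ <-]|[k Uk <-]] /=.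
- exact: reindex_bij (Zp_add_bij _ (Zp_opp j)).
- exact: reindex_bij (Zp_mul_inv_bij _ k Uk).
Qed.

Theorem corollary2p5 (R : realType) (l : nat) (hl : (0 < l)%N) :
  exists hD : transformation_group (groupD R l),
    group_action
      (fun (f : tgroup hD) (v : cvec R l) => tgroup_fun f v).
Proof. by exists (groupD_transformation R l). Qed.
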